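(* Let $\mathcal{A}$ be a finite set, let $(G_a)_{a\in\mathcal{A}}$ be a family of probabilistic graphs, and let $P_A \in \Delta(\mathcal{A})$ have full support (i.e. $P_A(a)>0$ for all $a\in\mathcal{A}$). Then $$\overline{H}\left(\bigsqcup_{a \in \mathcal{A}}^{P_A} G_a\right) = \sum_{a \in \mathcal{A}} P_A(a) \overline{H}(G_a) \iff \overline{H}\left(\bigwedge_{a \in \mathcal{A}} G_a\right) = \sum_{a \in \mathcal{A}} \overline{H}(G_a).$$
   Context: $\Delta(\mathcal{X})$ denotes the set of probability distributions on a finite set $\mathcal{X}$. A probabilistic graph is a tuple $G=(\mathcal{V},\mathcal{E},P_V)$ where $(\mathcal{V},\mathcal{E})$ is a finite simple undirected graph and $P_V\in\Delta(\mathcal{V})$. AND product: $G_1\wedge G_2$ has vertex set $\mathcal{V}_1\times\mathcal{V}_2$, distribution $P_{V_1}P_{V_2}$ (product distribution), and two distinct vertices $(v_1,v_2),(v_1',v_2')$ are adjacent iff ($v_1=v_1'$ or $v_1v_1'\in\mathcal{E}_1$) and ($v_2=v_2'$ or $v_2v_2'\in\mathcal{E}_2$). $G^{\wedge n}$ is the $n$-fold AND product $G\wedge\dots\wedge G$. Disjoint union: for $G_a=(\mathcal{V}_a,\mathcal{E}_a,P_{V_a})$, $\bigsqcup_{a\in\mathcal{A}}^{P_A}G_a$ has vertex set the disjoint union of the $\mathcal{V}_a$; two vertices are adjacent iff they lie in the same $\mathcal{V}_a$ and are adjacent in $G_a$; its distribution is $\sum_{a}P_A(a)P_{V_a}$.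 A coloring of $G$ is a map $c$ on $\mathcal{V}$ such that adjacent vertices receive different values. The chromatic entropy is $H_\chi(G)=\inf\{H(c(V)) : c \text{ a coloring of } G\}$, where $V\sim P_V$ and $H$ is Shannon entropy (logarithms in base 2). The complementary graph entropy is $\overline{H}(G)=\lim_{n\to\infty}\frac1n H_\chi(G^{\wedge n})$ (the limit exists). *)

(* Defs.v *)
From HB Require Import structures.
From mathcomp Require Import all_boot all_order all_algebra.
From mathcomp Require Import all_classical all_reals all_analysis.

Set Implicit Arguments.
Unset Strict Implicit.
Unset Printing Implicit Defensive.

Import Order.TTheory GRing.Theory Num.Theory numFieldNormedType.Exports.

Local Open Scope classical_set_scope.
Local Open Scope ring_scope.

Record dist (R : realType) (X : finType) := Dist {
  pmf :> X -> R;
  dist_ge0 : forall x, 0 <= pmf x;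
  dist_sum1 : \sum_x pmf x = 1 }.

Section Distributions.
Variable R : realType.

Section Image.
Variables (X Y : finType) (f : X -> Y) (P : dist R X).

Definition dist_map_pmf (y : Y) : R := \sum_(x | f x == y) P x.

Lemma dist_map_ge0 y : 0 <= dist_map_pmf y.
Proof. by apply: sumr_ge0 => x _; exact: dist_ge0. Qed.

Lemma dist_map_sum1 : \sum_y dist_map_pmf y = 1.
Proof. by rewrite -(dist_sum1 P) [RHS](partition_big f xpredT). Qed.

(* The law of f(V) when V has law P. *)
Definition dist_map : dist R Y := Dist dist_map_ge0 dist_map_sum1.
End Image.

Section Product.
Variables (A : finType) (X : A -> finType) (P : forall a, dist R (X a)).

Definition dist_prod_pmf (x : {dffun forall a, X a}) : R :=
  \prod_a P a (x a).

Lemma dist_prod_ge0 x : 0 <= dist_prod_pmf x.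
Proof. by apply: prodr_ge0 => a _; exact: dist_ge0. Qed.

Lemma dist_prod_sum1 : \sum_x dist_prod_pmf x = 1.
Proof.
pose p a := [ffun v => P a v].
rewrite (reindex (@dffun_of_fprod A X)) /=; last first.
  exact/onW_bij/dffun_of_fprod_bij.
transitivity (\sum_(g : fprod X) \prod_(a in A) p a (g a)).
  by apply: eq_bigr => g _; apply: eq_bigr => a _; rewrite /p !ffunE.
rewrite big_fprod -(bigA_distr_big_dep _ (fun a j => untag 0 (p a) j)).
rewrite big1 // => a _; rewrite -(big_tag p) -(dist_sum1 (P a)).
by apply: eq_bigr => v _; rewrite ffunE.
Qed.

Definition dist_prod : dist R {dffun forall a, X a} :=
  Dist dist_prod_ge0 dist_prod_sum1.
End Product.

Section Mixture.
Variables (A : finType) (X : A -> finType).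
Variables (PA : dist R A) (P : forall a, dist R (X a)).

Definition dist_mix_pmf (x : {a : A & X a}) : R :=
  PA (tag x) * P (tag x) (tagged x).

Lemma dist_mix_ge0 x : 0 <= dist_mix_pmf x.
Proof. by apply: mulr_ge0; exact: dist_ge0. Qed.

Lemma dist_mix_sum1 : \sum_x dist_mix_pmf x = 1.
Proof.
rewrite -(sig_big_dep xpredT (fun _ => xpredT) (fun a x => PA a * P a x)) /=.
rewrite -(dist_sum1 PA); apply: eq_bigr => a _.
by rewrite -big_distrr /= dist_sum1 mulr1.
Qed.

(* sum_a PA(a) P_a, each P_a being seen as a distribution on the disjoint
   union {a : A & X a} supported by the summand X a. *)
Definition dist_mix : dist R {a : A & X a} := Dist dist_mix_ge0 dist_mix_sum1.
End Mixture.

(* Entropy in bits; since [ln 0 = 0], the convention 0 log 0 = 0 is built in. *)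
Definition entropy (X : finType) (P : dist R X) : R :=
  - \sum_x P x * (ln (P x) / ln 2).

End Distributions.

Record pgraph (R : realType) := PGraph {
  vertex : finType;
  edge : rel vertex;
  edge_sym : symmetric edge;
  edge_irr : irreflexive edge;
  law : dist R vertex }.

Section Graphs.
Variable R : realType.

Section AndProduct.
Variables (A : finType) (G : A -> pgraph R).

Definition and_edge : rel {dffun forall a, vertex (G a)} :=
  fun v w => (v != w) && [forall a, (v a == w a) || edge (v a) (w a)].

Lemma and_edge_sym : symmetric and_edge.
Proof.
move=> v w; rewrite /and_edge eq_sym; congr (_ && _).
by apply: eq_forallb => a; rewrite eq_sym edge_sym.
Qed.

Lemma and_edge_irr : irreflexive and_edge.
Proof. by move=> v; rewrite /and_edge eqxx. Qed.

(* The AND product of a family indexed by an arbitrary finite type: unfolding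
   an iterated binary product, two distinct tuples of vertices are adjacent
   iff they are equal or adjacent in every coordinate. *)
Definition and_product : pgraph R :=
  PGraph and_edge_sym and_edge_irr (dist_prod (fun a => law (G a))).
End AndProduct.

Definition and_power (G : pgraph R) (n : nat) : pgraph R :=
  and_product (fun _ : 'I_n => G).

Section DisjointUnion.
Variables (A : finType) (PA : dist R A) (G : A -> pgraph R).

(* [tagged_as u v] is the vertex [v] seen in the component of [u]; it is only
   relevant when the two components are the same. *)
Definition union_edge : rel {a : A & vertex (G a)} :=
  fun u v => (tag u == tag v) && edge (tagged u) (tagged_as u v).

Lemma union_edge_sym : symmetric union_edge.
Proof.
move=> [a x] [b y]; rewrite /union_edge /= eq_sym.
case: (eqVneq b a) y => [-> y|//] /=.
by rewrite !tagged_asE edge_sym.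
Qed.

Lemma union_edge_irr : irreflexive union_edge.
Proof. by move=> [a x]; rewrite /union_edge tagged_asE edge_irr andbF. Qed.

Definition disjoint_union : pgraph R :=
  PGraph union_edge_sym union_edge_irr (dist_mix PA (fun a => law (G a))).
End DisjointUnion.

Definition coloring (G : pgraph R) (C : finType) (c : vertex G -> C) : Prop :=
  forall v w, edge v w -> c v != c w.

(* The vertex set being finite, a coloring takes finitely many values, so color
   sets are taken finite. *)
Definition chromatic_entropy (G : pgraph R) : R :=
  inf [set h | exists (C : finType) (c : vertex G -> C),
                 coloring c /\ h = entropy (dist_map c (law G))].

(* The term of rank 0 of the sequence is irrelevant to the limit. *)
Definition complementary_entropy (G : pgraph R) : R :=
  limn (fun n : nat => chromatic_entropy (and_power G n) / n%:R).

End Graphs.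

(* Main.v *)
(* For a vector k of nonnegative integers, let g(k) be the chromatic entropy of
   the AND product containing k_a copies of each G_a. This function is
   subadditive and monotone, g(n e_a) = H_chi(G_a^n), and
   g(n, ..., n) = H_chi((/\_a G_a)^n). The n-th AND power of the disjoint union
   is itself a disjoint union, over words w in A^n, of AND products with letter
   counts N(w); concavity of the entropy and colorings indexed by the type N(w)
   show that its chromatic entropy is E[g(N)] + O(log n), with N multinomial.
   Hence the complementary entropies U of the union and S of the product are
   the values at P_A and at (1, ..., 1) of the convex, positively homogeneous
   asymptotic growth of g, which is dominated by the linear map
   L(x) = sum_a x_a H(G_a). Such a function touches L at one interior point of
   the orthant iff it does at every one. Concretely: U <= L(P_A), S <= L(1),
   S <= U + L(1 - P_A), and q U <= S + L(q P_A - 1) once q P_A >= 1. *)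
Require Import Defs.
From mathcomp Require Import all_boot all_order all_algebra.
From mathcomp Require Import all_classical all_reals all_analysis.
From mathcomp Require Import ring lra.

Set Implicit Arguments.
Unset Strict Implicit.
Unset Printing Implicit Defensive.

Import Order.TTheory GRing.Theory Num.Theory numFieldNormedType.Exports.

Local Open Scope ring_scope.

(** * Expectation under finite distributions *)

Section Expectation.
Variable R : realType.

Definition mean (X : finType) (P : dist R X) (f : X -> R) : R :=
  \sum_x P x * f x.

Section Basic.
Variables (X : finType) (P : dist R X).
Implicit Types f g : X -> R.

Lemma meanD f g :
  mean P (fun x => f x + g x) = mean P f + mean P g.
Proof. by rewrite -big_split; apply: eq_bigr => x _; rewrite mulrDr. Qed.

Lemma meanZ c f :
  mean P (fun x => c * f x) = c * mean P f.
Proof. by rewrite /mean mulr_sumr; apply: eq_bigr => x _; ring. Qed.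

Lemma mean_cst c : mean P (fun=> c) = c.
Proof. by rewrite /mean -mulr_suml dist_sum1 mul1r. Qed.

Lemma mean_sum (I : finType) (f : I -> X -> R) :
  mean P (fun x => \sum_i f i x) = \sum_i mean P (f i).
Proof.
by rewrite exchange_big; apply: eq_bigr => x _; rewrite mulr_sumr.
Qed.

Lemma ler_mean f g :
  (forall x, f x <= g x) -> mean P f <= mean P g.
Proof.
by move=> fg; apply: ler_sum => x _; apply: ler_wpM2l => //; exact: dist_ge0.
Qed.

Lemma eq_mean f g : f =1 g -> mean P f = mean P g.
Proof. by move=> fg; apply: eq_bigr => x _; rewrite fg. Qed.

Lemma mean_map (Y : finType) (h : X -> Y) (f : Y -> R) :
  mean (dist_map h P) f = mean P (fun x => f (h x)).
Proof.
rewrite /mean [RHS](partition_big h xpredT) //=.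
by apply: eq_bigr => y _; rewrite mulr_suml; apply: eq_bigr => x /eqP ->.
Qed.

End Basic.

(** The generalized distributive law for dependent families, reached by passing to [fprod]. *)
Lemma dffun_sum_prod (I : finType) (X : I -> finType)
    (F : forall i, X i -> R) :
  \sum_(x : {dffun forall i, X i}) \prod_i F i (x i) = \prod_i \sum_v F i v.
Proof.
pose p i := [ffun v => F i v].
rewrite (reindex (@dffun_of_fprod I X)) /=; last first.
  exact/onW_bij/dffun_of_fprod_bij.
transitivity (\sum_(g : fprod X) \prod_(i in I) p i (g i)).
  by apply: eq_bigr => g _; apply: eq_bigr => i _; rewrite /p !ffunE.
rewrite big_fprod -(bigA_distr_big_dep _ (fun i j => untag 0 (p i) j)).
apply: eq_bigr => i _; rewrite -(big_tag p).
by apply: eq_bigr => v _; rewrite ffunE.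
Qed.

Lemma mean_prod (I : finType) (X : I -> finType)
    (P : forall i, dist R (X i)) (F : forall i, X i -> R) :
  mean (dist_prod P) (fun x => \prod_i F i (x i))
    = \prod_i mean (P i) (F i).
Proof.
rewrite -dffun_sum_prod; apply: eq_bigr => x _.
by rewrite -big_split.
Qed.

Lemma prodr_bool (I : finType) (b : I -> bool) :
  \prod_i ((b i)%:R : R) = [forall i, b i]%:R.
Proof.
case: (boolP [forall i, b i]) => [/forallP h|].
  by rewrite big1 // => i _; rewrite h.
by case/forallPn => i /negbTE hi; rewrite (bigD1 i) //= hi mul0r.
Qed.

Lemma mean_indicator (X : finType) (P : dist R X) (y : X) :
  mean P (fun x => (x == y)%:R) = P y.
Proof.
rewrite /mean (bigD1 y) //= eqxx mulr1 big1 ?addr0 // => x /negbTE ->.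
by rewrite mulr0.
Qed.

(** Probabilities become means of indicators, so that equalities between laws follow from the rules
    for [mean]. *)
Lemma dist_mapE (X Y : finType) (h : X -> Y) (P : dist R X) y :
  dist_map h P y = mean P (fun x => (h x == y)%:R).
Proof. by rewrite -mean_indicator mean_map. Qed.

Lemma mean_mix (I : finType) (X : I -> finType) (PI : dist R I)
    (P : forall i, dist R (X i)) (f : {i : I & X i} -> R) :
  mean (dist_mix PI P) f
    = mean PI (fun i => mean (P i) (fun x => f (Tagged X x))).
Proof.
pose F i (x : X i) := PI i * P i x * f (Tagged X x).
transitivity (\sum_i \sum_(x : X i) F i x).
  rewrite (sig_big_dep xpredT (fun _ => xpredT)) /=.
  by apply: eq_bigr => -[i x] _.
apply: eq_bigr => i _; rewrite mulr_sumr; apply: eq_bigr => x _.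
by rewrite /F mulrA.
Qed.

Lemma eq_mean_dist (X : finType) (P Q : dist R X) f :
  P =1 Q -> mean P f = mean Q f.
Proof. by move=> PQ; apply: eq_bigr => x _; rewrite PQ. Qed.

End Expectation.

(** * Entropy: Gibbs' inequality, concavity and the chain rule *)

Section Entropy.
Variable R : realType.

Definition bits (x : R) : R := ln x / ln 2.

Lemma ln2_gt0 : 0 < ln 2 :> R.
Proof. by rewrite ln_gt0 // ltr1n. Qed.

Lemma bitsM : {in Num.pos &, {morph bits : x y / x * y >-> x + y}}.
Proof. by move=> x y hx hy; rewrite /bits lnM // mulrDl. Qed.

Lemma entropyE (X : finType) (P : dist R X) :
  entropy P = - mean P (fun x => bits (P x)).
Proof. by []. Qed.

Lemma eq_entropy (X : finType) (P Q : dist R X) :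
  P =1 Q -> entropy P = entropy Q.
Proof. by move=> PQ; congr (- _); apply: eq_bigr => x _; rewrite PQ. Qed.

Lemma dist_le1 (X : finType) (P : dist R X) x : P x <= 1.
Proof.
rewrite -(dist_sum1 P) (bigD1 x) //= lerDl.
by apply: sumr_ge0 => y _; exact: dist_ge0.
Qed.

Lemma entropy_ge0 (X : finType) (P : dist R X) : 0 <= entropy P.
Proof.
rewrite oppr_ge0; apply: sumr_le0 => x _.
apply: mulr_ge0_le0; first exact: dist_ge0.
by rewrite mulr_le0_ge0 ?ln_le0 ?dist_le1 // invr_ge0 ltW // ln2_gt0.
Qed.

Lemma ln_leB1 (x : R) : 0 < x -> ln x <= x - 1.
Proof.
move=> x0; have -> : ln x = ln (1 + (x - 1)) by congr ln; ring.
by apply: le_ln1Dx; lra.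
Qed.

(* Gibbs' inequality; domination is needed because [ln 0 = 0]. *)
Lemma entropy_le_cross (X : finType) (P : dist R X) (q : X -> R) :
  (forall x, 0 < P x -> 0 < q x) -> (forall x, 0 <= q x) ->
  \sum_x q x <= 1 ->
  entropy P <= - mean P (fun x => bits (q x)).
Proof.
move=> Pq q0 q1; rewrite entropyE lerN2 -subr_ge0.
have -> : mean P (fun x => bits (P x)) - mean P (fun x => bits (q x))
    = (\sum_x P x * (ln (P x) - ln (q x))) / ln 2.
  by rewrite -sumrB mulr_suml; apply: eq_bigr => x _; rewrite /bits; ring.
rewrite divr_ge0 //; last exact/ltW/ln2_gt0.
apply: (@le_trans _ _ (\sum_x (P x - q x))).
  by rewrite sumrB dist_sum1 subr_ge0.
apply: ler_sum => x _.
have := dist_ge0 P x; rewrite le0r => /predU1P[-> | Px].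
  by rewrite sub0r mul0r oppr_le0.
have qx := Pq _ Px.
have : ln (q x / P x) <= q x / P x - 1 by rewrite ln_leB1 // divr_gt0.
rewrite lnM ?posrE ?invr_gt0 // lnV ?posrE // => h.
have {h} : P x * (ln (q x) - ln (P x)) <= P x * (q x / P x - 1).
  by rewrite ler_wpM2l // ltW.
rewrite [X in _ <= X]mulrBr mulr1 mulrCA divff ?gt_eqF // mulr1; lra.
Qed.

Lemma entropy_le_card (X : finType) (P : dist R X) :
  entropy P <= bits #|X|%:R.
Proof.
have X0 : 0 < #|X|%:R :> R.
  rewrite ltr0n lt0n; apply/eqP => /card0_eq X0.
  have := dist_sum1 P; rewrite big_pred0 => [/esym/eqP|x]; last exact: X0.
  by rewrite oner_eq0.
have V0 : 0 < #|X|%:R^-1 :> R by rewrite invr_gt0.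
have V1 : \sum_(x : X) #|X|%:R^-1 <= 1 :> R.
  by rewrite sumr_const -[_ *+ #|_|]mulr_natl divff // gt_eqF.
have := @entropy_le_cross _ P (fun=> #|X|%:R^-1) (fun _ _ => V0)
  (fun=> ltW V0) V1.
by rewrite mean_cst /bits lnV // mulNr opprK.
Qed.

(** The entropy of [P] is the average over [z] of the cross entropies of [mu z] against [P], and
    Gibbs' inequality bounds each of them from below. *)
Lemma entropy_concave (Z X : finType) (L : dist R Z) (mu : Z -> dist R X)
    (P : dist R X) :
  (forall x, P x = mean L (fun z => mu z x)) ->
  mean L (fun z => entropy (mu z)) <= entropy P.
Proof.
move=> PE.
have -> : entropy P =
    mean L (fun z => - mean (mu z) (fun x => bits (P x))).
  rewrite entropyE -mulN1r -meanZ /mean.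
  under [RHS]eq_bigr => z _ do rewrite -mulN1r -/(mean _ _) -meanZ mulr_sumr.
  rewrite exchange_big; apply: eq_bigr => x _ /=.
  rewrite PE mulr_suml; apply: eq_bigr => z _; ring.
apply: ler_sum => z _.
(* Where [L z] is 0, [P] need not dominate [mu z]; that term is disposed of first. *)
have := dist_ge0 L z; rewrite le0r => /predU1P[-> | Lz]; first by rewrite !mul0r.
apply: ler_wpM2l; first exact: ltW.
apply: (@entropy_le_cross _ (mu z) P) => [x mx|x|].
- rewrite PE /mean (bigD1 z) //= ltr_pwDl ?mulr_gt0 //.
  by apply: sumr_ge0 => y _; rewrite mulr_ge0 // dist_ge0.
- exact: dist_ge0.
- by rewrite dist_sum1.
Qed.

(** The chain rule, the index being a function of the tagged value. Null masses are treated apart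
    because [bitsM] needs positive arguments. *)
Lemma entropy_mix (I : finType) (X : I -> finType) (PI : dist R I)
    (P : forall i, dist R (X i)) :
  entropy (dist_mix PI P)
    = entropy PI + mean PI (fun i => entropy (P i)).
Proof.
rewrite entropyE mean_mix entropyE.
rewrite -[X in X + _]mulN1r -[LHS]mulN1r -!meanZ -meanD.
apply: eq_bigr => i _.
have := dist_ge0 (PI) i; rewrite le0r => /predU1P[-> | Pi0]; first by rewrite !mul0r.
congr (_ * _); rewrite entropyE !mulN1r -opprD; congr (- _).
rewrite -[X in X + _](mean_cst (P i)) -meanD.
apply: eq_bigr => x _.
have := dist_ge0 (P i) x; rewrite le0r => /predU1P[-> | Px]; first by rewrite !mul0r.
by rewrite /= /dist_mix_pmf /= bitsM.
Qed.

End Entropy.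

(** * Chromatic entropy under graph maps, mixtures and unions *)

Section ChromaticEntropy.
Variable R : realType.
Implicit Types X Y : pgraph R.

Lemma coloring_id X : coloring (@id (vertex X)).
Proof. by move=> v w; apply: contraTneq => ->; rewrite edge_irr. Qed.

Lemma chromatic_entropy_le X (C : finType) (c : vertex X -> C) :
  coloring c -> chromatic_entropy X <= entropy (dist_map c (law X)).
Proof.
move=> cc; apply: ge_inf; last by exists C, c.
by exists 0 => _ [D [d [_ ->]]]; exact: entropy_ge0.
Qed.

Lemma le_chromatic_entropy X b :
  (forall (C : finType) (c : vertex X -> C),
    coloring c -> b <= entropy (dist_map c (law X))) ->
  b <= chromatic_entropy X.
Proof.
move=> h; apply: lb_le_inf; last by move=> _ [C [c [cc ->]]]; exact: h.
by exists (entropy (dist_map id (law X))), (vertex X), id; split=> //; exact: coloring_id.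
Qed.

Lemma chromatic_entropy_ge0 X : 0 <= chromatic_entropy X.
Proof. by apply: le_chromatic_entropy => C c _; exact: entropy_ge0. Qed.

Lemma chromatic_entropy_adherent X d : 0 < d ->
  exists (C : finType) (c : vertex X -> C),
    coloring c /\ entropy (dist_map c (law X)) < chromatic_entropy X + d.
Proof.
move=> d0; apply: contrapT => hn.
suff : chromatic_entropy X + d <= chromatic_entropy X by lra.
apply: le_chromatic_entropy => C c cc; rewrite leNgt; apply/negP => hlt.
by apply: hn; exists C, c.
Qed.

Lemma chromatic_entropy_le_log_card X :
  chromatic_entropy X <= bits #|vertex X|%:R.
Proof.
exact: le_trans (chromatic_entropy_le (@coloring_id X)) (entropy_le_card _).
Qed.

(** A coloring of [Y] pulls back along [h] to a coloring of [X] with the same color law. *)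
Lemma chromatic_entropy_hom X Y (h : vertex X -> vertex Y) :
  (forall v w, edge v w -> edge (h v) (h w)) ->
  law Y =1 dist_map h (law X) ->
  chromatic_entropy X <= chromatic_entropy Y.
Proof.
move=> eh lh; apply: le_chromatic_entropy => C c cc.
have ch : coloring (c \o h) by move=> v w /eh; exact: cc.
apply: le_trans (chromatic_entropy_le ch) _; rewrite le_eqVlt; apply/orP; left.
apply/eqP/eq_entropy => y; rewrite !dist_mapE.
by rewrite (eq_mean_dist _ lh) mean_map.
Qed.

(* The vertices outside the image of [f] carry no mass; each of them is its own
   color class. *)
Lemma chromatic_entropy_embed X Y (f : vertex Y -> vertex X) :
  injective f -> (forall v w, edge (f v) (f w) -> edge v w) ->
  law X =1 dist_map f (law Y) ->
  chromatic_entropy X <= chromatic_entropy Y.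
Proof.
move=> fI ef lf; apply: le_chromatic_entropy => C c cc.
pose d x : C + vertex X := if [pick y | f y == x] is Some y then inl (c y) else inr x.
have df y : d (f y) = inl (c y).
  by rewrite /d; case: pickP => [z /eqP/fI -> //|/(_ y)]; rewrite eqxx.
have dc : coloring d.
  move=> v w evw; rewrite /d.
  case: pickP => [y /eqP yv|_]; case: pickP => [z /eqP zw|_] //=.
    by rewrite -yv -zw in evw; have := cc _ _ (ef _ _ evw).
  by apply: contraTneq evw => -[->]; rewrite edge_irr.
apply: le_trans (chromatic_entropy_le dc) _.
pose i (x : C) : C + vertex X := inl x.
have -> : entropy (dist_map d (law X)) = entropy (dist_map i (dist_map c (law Y))).
  apply: eq_entropy => y; rewrite !dist_mapE !mean_map.
  rewrite (eq_mean_dist _ lf) mean_map.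
  by apply: eq_mean => v; rewrite df.
rewrite entropyE mean_map entropyE lerN2 le_eqVlt; apply/orP; left.
apply/eqP/eq_mean => x; congr (bits _).
rewrite [RHS]dist_mapE -[LHS]mean_indicator.
by apply: eq_mean => z; rewrite (inj_eq (@inl_inj _ _)).
Qed.

(** A coloring of [X] pulls back to every [Y z], and its color law is the mixture of the pulled-back
    ones; concavity of entropy concludes. *)
Lemma chromatic_entropy_mixture X (Z : finType) (L : dist R Z)
    (Y : Z -> pgraph R) (h : forall z, vertex (Y z) -> vertex X) :
  (forall z v w, edge v w -> edge (h z v) (h z w)) ->
  (forall x, law X x = mean L (fun z => dist_map (h z) (law (Y z)) x)) ->
  mean L (fun z => chromatic_entropy (Y z)) <= chromatic_entropy X.
Proof.
move=> eh lh; apply: le_chromatic_entropy => C c cc.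
have ch z : coloring (c \o h z) by move=> v w /eh; exact: cc.
apply: le_trans (ler_mean L (fun z => chromatic_entropy_le (ch z))) _.
apply: entropy_concave => y.
rewrite dist_mapE {1}/mean; under eq_bigr => x _ do rewrite lh mulr_suml.
rewrite exchange_big /=; apply: eq_bigr => z _.
under eq_bigr => x _ do rewrite -mulrA; rewrite -mulr_sumr; congr (_ * _).
by rewrite [RHS]dist_mapE; exact: (mean_map _ _ (fun x => (c x == y)%:R)).
Qed.

(** Nearly optimal colorings of the components are glued with disjoint palettes. The color then
    determines the component, and the chain rule evaluates the entropy. *)
Lemma chromatic_entropy_union (Z : finType) (L : dist R Z) (Y : Z -> pgraph R) :
  chromatic_entropy (disjoint_union L Y)
    <= entropy L + mean L (fun z => chromatic_entropy (Y z)).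
Proof.
apply/ler_addgt0Pr => d d0.
have hC z := cid (chromatic_entropy_adherent (Y z) d0).
pose C z := sval (hC z).
have hc' z := cid (svalP (hC z)).
pose c z : vertex (Y z) -> C z := sval (hc' z).
have hc z : coloring (c z) /\
    entropy (dist_map (c z) (law (Y z))) < chromatic_entropy (Y z) + d.
  exact: svalP (hc' z).
pose k (v : {z : Z & vertex (Y z)}) : {z : Z & C z} :=
  Tagged C (c (tag v) (tagged v)).
have kc : @coloring _ (disjoint_union L Y) _ k.
  move=> [a x] [b y]; rewrite /= /union_edge /=.
  case: (eqVneq a b) y => [<- y|//] /=; rewrite tagged_asE => exy.
  rewrite /k -tag_eqE /tag_eq /= eqxx tagged_asE.
  by have [+ _] := hc a; apply.
apply: le_trans (chromatic_entropy_le kc) _.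
have -> : entropy (dist_map k (law (disjoint_union L Y)))
    = entropy (dist_mix L (fun z => dist_map (c z) (law (Y z)))).
  apply: eq_entropy => y; rewrite dist_mapE -[RHS]mean_indicator.
  rewrite !mean_mix; apply: eq_mean => z.
  by rewrite mean_map.
rewrite entropy_mix -addrA lerD2l -[d in X in _ <= X](mean_cst L).
rewrite -meanD; apply: ler_mean => z.
by have [_ /ltW] := hc z.
Qed.

End ChromaticEntropy.

(** * AND products of one graph under varying laws *)

Section Words.
Variable R : realType.

(** Keeping one graph and changing only its law puts all words of a given length on the same vertex
    set, where their laws can be mixed. *)
Definition with_law (X : pgraph R) (P : dist R (vertex X)) : pgraph R :=
  PGraph (@edge_sym R X) (@edge_irr R X) P.

Definition word_graph (X : pgraph R) (I : finType) (Q : I -> dist R (vertex X)) :=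
  and_product (fun i => with_law (Q i)).

Lemma mean_prod_sum (I J : finType) (V : finType) (Q : I + J -> dist R V)
    (f : {dffun forall i : I, V} -> {dffun forall j : J, V} -> R) :
  mean (dist_prod Q) (fun x => f [ffun i => x (inl i)] [ffun j => x (inr j)])
  = mean (dist_prod (fun i => Q (inl i))) (fun y =>
      mean (dist_prod (fun j => Q (inr j))) (f y)).
Proof.
pose join (p : {dffun forall i : I, V} * {dffun forall j : J, V}) :
    {dffun forall k : I + J, V} :=
  [ffun k => match k with inl i => p.1 i | inr j => p.2 j end].
rewrite /mean (reindex join) /=; last first.
  exists (fun x : {dffun forall k : I + J, V} =>
    ([ffun i => x (inl i)], [ffun j => x (inr j)]) :
      {dffun forall i : I, V} * {dffun forall j : J, V}) => [[y z] _|x _].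
    by congr (_, _); apply/ffunP => i; rewrite !ffunE.
  by apply/ffunP => -[i|j]; rewrite !ffunE.
under [RHS]eq_bigr => y _ do rewrite mulr_sumr.
rewrite pair_big /=; apply: eq_bigr => -[y z] _ /=.
have -> : [ffun i => join (y, z) (inl i)] = y by apply/ffunP => i; rewrite !ffunE.
have -> : [ffun j => join (y, z) (inr j)] = z by apply/ffunP => i; rewrite !ffunE.
rewrite mulrA; congr (_ * _).
rewrite /dist_prod_pmf big_sumType /=; congr (_ * _);
  by apply: eq_bigr => i _; rewrite ffunE.
Qed.

(** Color the two halves of a tuple separately. Two distinct adjacent tuples differ in some half,
    and are adjacent there. The two colors are independent, so their entropies add up. *)
Lemma chromatic_entropy_word_sum (X : pgraph R) (I J : finType)
    (Q : I + J -> dist R (vertex X)) :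
  chromatic_entropy (word_graph Q)
    <= chromatic_entropy (word_graph (fun i => Q (inl i)))
       + chromatic_entropy (word_graph (fun j => Q (inr j))).
Proof.
rewrite -lerBlDr; apply: le_chromatic_entropy => C c cc.
rewrite lerBlDr addrC -lerBlDr; apply: le_chromatic_entropy => D d dc.
rewrite lerBlDr addrC.
pose xl (x : vertex (word_graph Q)) :
    vertex (word_graph (fun i => Q (inl i))) := [ffun i => x (inl i)].
pose xr (x : vertex (word_graph Q)) :
    vertex (word_graph (fun j => Q (inr j))) := [ffun j => x (inr j)].
(* The pair of colors is encoded as a tagged value, so that [entropy_mix] with a constant second law
   gives additivity. *)
pose k (x : vertex (word_graph Q)) : {_ : C & D} :=
  Tagged (fun=> D) (i := c (xl x)) (d (xr x)).
have kc : coloring k.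
  move=> x y /andP[nxy /forallP exy].
  have [exl|nxl] := eqVneq (xl x) (xl y).
    have nxr : xr x != xr y.
      apply: contraNneq nxy => exr; apply/eqP/ffunP => -[i|j].
        by move/ffunP: exl => /(_ i); rewrite !ffunE.
      by move/ffunP: exr => /(_ j); rewrite !ffunE.
    rewrite -tag_eqE /tag_eq /= exl eqxx /k exl tagged_asE /=.
    apply: dc; rewrite /= /and_edge nxr; apply/forallP => j.
    by rewrite !ffunE; exact: exy.
  have := cc (xl x) (xl y); rewrite /= /and_edge nxl => ccx.
  rewrite -tag_eqE /tag_eq /= negb_and ccx //; apply/forallP => i.
  by rewrite !ffunE; exact: exy.
apply: le_trans (chromatic_entropy_le kc) _.
set P1 := dist_map c _; set P2 := dist_map d _.
have -> : entropy P1 + entropy P2 = entropy (dist_mix P1 (fun=> P2)).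
  by rewrite entropy_mix mean_cst.
rewrite le_eqVlt; apply/orP; left; apply/eqP/eq_entropy => y.
rewrite dist_mapE -[RHS]mean_indicator mean_mix mean_map.
rewrite (mean_prod_sum _ (fun u v => (Tagged (fun=> D) (i := c u) (d v) == y)%:R)).
by apply: eq_mean => u; rewrite mean_map.
Qed.

(** Freeze the coordinates outside the image of [s] at those of [z]. Each [merge z] preserves edges,
    since frozen coordinates are equal, and averaging over a random [z] recovers the full product
    law; the mixture bound applies. *)
Lemma chromatic_entropy_word_mono (X : pgraph R) (I J : finType)
    (Q : I -> dist R (vertex X)) (s : J -> I) : injective s ->
  chromatic_entropy (word_graph (fun j => Q (s j)))
    <= chromatic_entropy (word_graph Q).
Proof.
move=> sI.
pose merge (z : vertex (word_graph Q)) (y : vertex (word_graph (fun j => Q (s j)))) :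
    vertex (word_graph Q) :=
  [ffun i => if [pick j | s j == i] is Some j then y j else z i].
have mergeE z y j : merge z y (s j) = y j.
  rewrite /merge ffunE; case: pickP => [j' /eqP/sI -> //|/(_ j)].
  by rewrite eqxx.
have mergeN z y i : i \notin codom s -> merge z y i = z i.
  move=> hi; rewrite /merge ffunE; case: pickP => [j' /eqP ji|//].
  by rewrite -ji codom_f in hi.
set Y := word_graph (fun j => Q (s j)).
rewrite -(mean_cst (law (word_graph Q)) (chromatic_entropy Y)).
apply: (@chromatic_entropy_mixture _ (word_graph Q) _ _ (fun=> Y) merge).
  move=> z v w /andP[nvw /forallP evw]; apply/andP; split.
    apply: contraNneq nvw => /ffunP mvw; apply/eqP/ffunP => j.
    by rewrite -(mergeE z v) mvw mergeE.
  apply/forallP => i; case: (boolP (i \in codom s)) => [/codomP[j ->]|hi].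
    by rewrite !mergeE; exact: evw.
  by rewrite !mergeN // eqxx.
move=> x.
(* The event that the merged tuple is [x] splits into conditions on single coordinates: [F] tests
   [z] outside the image of [s], and [H] tests [y]. *)
pose F i v : R := ((i \in codom s) || (v == x i))%:R.
pose H j v : R := (v == x (s j))%:R.
have fE z y : (merge z y == x)%:R = \prod_i F i (z i) * \prod_j H j (y j).
  rewrite /F /H !prodr_bool -natrM mulnb; congr (_%:R); congr nat_of_bool.
  apply/eqP/andP => [<-|[/forallP hz /forallP hy]].
    split; apply/forallP => i; last by rewrite mergeE.
    by case: (boolP (i \in codom s)) => //= hi; rewrite mergeN.
  apply/ffunP => i; case: (boolP (i \in codom s)) => [/codomP[j ->]|hi].
    by rewrite mergeE; apply/eqP.
  by rewrite mergeN //; have := hz i; rewrite (negbTE hi) => /eqP.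
under eq_mean => z.
  rewrite dist_mapE.
  under eq_mean => y do rewrite fE.
  rewrite meanZ (mean_prod (fun j => Q (s j)) H).
  rewrite mulrC.
  over.
rewrite meanZ (mean_prod Q F) /=.
have -> : \prod_i mean (Q i) (F i) = \prod_(i | i \notin codom s) Q i (x i).
  rewrite (bigID (mem (codom s))) /= big1 ?mul1r => [|i si].
    by apply: eq_bigr => i /negbTE si; rewrite -mean_indicator /F si.
  rewrite -[RHS](mean_cst (Q i)).
  by apply: eq_mean => v; rewrite /F si.
rewrite /dist_prod_pmf (bigID (mem (codom s))) /=; congr (_ * _).
rewrite (eq_bigl (mem [set s j | j : J])) => [|i]; last first.
  apply/idP/idP => [/codomP[j ->]|/imsetP[j _ ->]]; last exact: codom_f.
  exact: imset_f.
rewrite big_imset /=; last by move=> ? ? _ _ /sI.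
by apply: eq_bigr => j _; rewrite -mean_indicator.
Qed.

End Words.

(** * Words, their letter counts, and random words *)

Lemma fiberwise_injection (I J A : finType) (w : I -> A) (W : J -> A) :
  (forall a, #|[pred i | w i == a]| <= #|[pred j | W j == a]|)%N ->
  exists2 s : I -> J, injective s & forall i, W (s i) = w i.
Proof.
(* [nth] needs a default element of [J]; if [J] is empty, the counts force [I] to be empty too. *)
move=> h; case: (pickP (@predT J)) => [j0 _|J0]; last first.
  have I0 (i : I) : False.
    have := h (w i); rewrite [X in (_ <= X)%N]eq_card0 => [|j]; last by have := J0 j.
    by rewrite leqn0 => /eqP/card0_eq/(_ i); rewrite !inE eqxx.
  by exists (fun i => False_rect J (I0 i)) => i; case: (I0 i).
pose E a := enum [pred j | W j == a]; pose D a := enum [pred i | w i == a].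
(* The k-th occurrence of a letter in [w] goes to its k-th occurrence in [W], which exists by the
   comparison of counts. *)
pose s i := nth j0 (E (w i)) (index i (D (w i))).
have ltE i : (index i (D (w i)) < size (E (w i)))%N.
  rewrite -cardE (leq_trans _ (h (w i))) // cardE index_mem mem_enum !inE.
  by rewrite eqxx.
have ws i : W (s i) = w i.
  by have := mem_nth j0 (ltE i); rewrite -/(s i) mem_enum !inE => /eqP.
exists s => // i i' ss.
have ww : w i = w i' by rewrite -!ws ss.
have := ltE i'; have := ltE i; move: ss; rewrite /s -ww => /eqP ss l1 l2.
rewrite nth_uniq ?enum_uniq // in ss.
have m (k : I) : w k = w i -> k \in D (w i) by move=> e; rewrite mem_enum !inE e.
by rewrite -(nth_index i (m i erefl)) (eqP ss) nth_index // m.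
Qed.

Section Letters.
Variables (R : realType) (A : finType) (X : pgraph R).
Variable Q : A -> dist R (vertex X).

Definition occ (I : finType) (w : I -> A) (a : A) : nat := #|[pred i | w i == a]|.

Lemma occ_tag (k : A -> nat) a : occ (tag : {a : A & 'I_(k a)} -> A) a = k a.
Proof.
rewrite /occ -sum1_card.
transitivity (\sum_(b | b == a) \sum_(j < k b) 1)%N.
  rewrite (sig_big_dep (pred1 a) (fun _ => xpredT) (fun _ _ => 1%N)) /=.
  by apply: eq_bigl => p; rewrite andbT.
by rewrite big_pred1_eq sum1_card card_ord.
Qed.

Lemma occ_sum (I J : finType) (w : I + J -> A) a :
  occ w a = (occ (fun i => w (inl i)) a + occ (fun j => w (inr j)) a)%N.
Proof. by rewrite /occ -!sum1_card big_sumType. Qed.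

(** The function g of the overview, taken on a canonical word whose positions are pairs of a letter
    and a copy number. *)
Definition counts_entropy (k : A -> nat) : R :=
  chromatic_entropy (word_graph (fun p : {a : A & 'I_(k a)} => Q (tag p))).
Local Notation g := counts_entropy.

(** Up to reordering, [v] is a subword of [w]. In particular, the chromatic entropy of a word
    depends only on its letter counts. *)
Lemma word_entropy_mono (I J : finType) (v : I -> A) (w : J -> A) :
  (forall a, occ v a <= occ w a)%N ->
  chromatic_entropy (word_graph (fun i => Q (v i)))
    <= chromatic_entropy (word_graph (fun j => Q (w j))).
Proof.
move=> /fiberwise_injection[s sI ws].
have := chromatic_entropy_word_mono (fun j => Q (w j)) sI.
by rewrite (_ : (fun i => Q (w (s i))) = fun i => Q (v i)) //; apply/funext => i; rewrite ws.
Qed.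

Lemma word_entropy_le (I : finType) (w : I -> A) k :
  (forall a, occ w a <= k a)%N ->
  chromatic_entropy (word_graph (fun i => Q (w i))) <= g k.
Proof. by move=> h; apply: word_entropy_mono => a; rewrite occ_tag. Qed.

Lemma le_word_entropy (I : finType) (w : I -> A) k :
  (forall a, k a <= occ w a)%N ->
  g k <= chromatic_entropy (word_graph (fun i => Q (w i))).
Proof. by move=> h; apply: word_entropy_mono => a; rewrite occ_tag. Qed.

Lemma counts_entropy_mono k l : (forall a, k a <= l a)%N -> g k <= g l.
Proof. by move=> h; apply: word_entropy_mono => a; rewrite !occ_tag. Qed.

Lemma counts_entropyD k l : g (fun a => k a + l a)%N <= g k + g l.
Proof.
pose w (p : {a : A & 'I_(k a)} + {a : A & 'I_(l a)}) :=
  match p with inl p => tag p | inr p => tag p end.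
apply: le_trans (chromatic_entropy_word_sum (fun p => Q (w p))).
by apply: le_word_entropy => a; rewrite occ_sum !occ_tag.
Qed.

Lemma counts_entropy_ge0 k : 0 <= g k.
Proof. exact: chromatic_entropy_ge0. Qed.

Lemma counts_entropy0 : g (fun=> 0%N) = 0.
Proof.
apply/eqP; rewrite eq_le counts_entropy_ge0 andbT.
apply: le_trans (chromatic_entropy_le_log_card _) _.
suff -> : #|vertex (word_graph (fun p : {a : A & 'I_0} => Q (tag p)))| = 1%N.
  by rewrite /bits ln1 mul0r.
have c0 : #|{: {a : A & 'I_0}}| = 0%N by apply: eq_card0 => -[a []].
by have := card_ffun ({a : A & 'I_0} : finType) (vertex X); rewrite c0 expn0.
Qed.

Definition single (a : A) (n : nat) (b : A) : nat := if b == a then n else 0.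

(** Subadditivity along the decomposition of [k] into one vector per letter, by induction on the
    list of letters. *)
Lemma counts_entropy_le_sum k : g k <= \sum_a g (single a (k a)).
Proof.
have h (s : seq A) :
    g (fun b => \sum_(a <- s) single a (k a) b)%N <= \sum_(a <- s) g (single a (k a)).
  elim: s => [|a s IH].
    by rewrite big_nil -[X in _ <= X]counts_entropy0; apply: counts_entropy_mono => b; rewrite big_nil.
  rewrite big_cons; apply: le_trans (lerD (lexx _) IH).
  apply: le_trans (counts_entropyD _ _).
  by apply: counts_entropy_mono => b; rewrite big_cons.
apply: le_trans (h (index_enum A)); apply: counts_entropy_mono => b.
by rewrite (bigD1 b) //= {1}/single eqxx leq_addr.
Qed.

Variables (PA : dist R A) (P : dist R (vertex X)).
Hypothesis PE : forall v, P v = mean PA (fun a => Q a v).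

Definition word_law (n : nat) : dist R {dffun forall i : 'I_n, A} :=
  dist_prod (fun _ => PA).

(** A product of independent mixtures is a mixture over words of independent letters: expand the
    product of means. *)
Lemma mixture_prod n x :
  dist_prod (fun _ : 'I_n => P) x
    = mean (word_law n) (fun w => dist_prod (fun i => Q (w i)) x).
Proof.
rewrite [RHS](mean_prod (fun _ : 'I_n => PA) (fun i a => Q a (x i))).
by apply: eq_bigr => i _; exact: PE.
Qed.

Lemma mean_mixture_prod n f :
  mean (dist_prod (fun _ : 'I_n => P)) f
    = mean (word_law n) (fun w => mean (dist_prod (fun i => Q (w i))) f).
Proof.
rewrite /mean; under eq_bigr => x _ do rewrite mixture_prod mulr_suml.
rewrite exchange_big; apply: eq_bigr => w _ /=.
by rewrite mulr_sumr; apply: eq_bigr => x _; rewrite mulrA.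
Qed.

(** Drawing every coordinate from [P] amounts to drawing a random word first. The graph does not
    change, so the mixture bound applies with identity maps. *)
Lemma mean_counts_entropy_le n :
  mean (word_law n) (fun w => g (occ w))
    <= chromatic_entropy (word_graph (fun _ : 'I_n => P)).
Proof.
apply: (@le_trans _ _ (mean (word_law n)
    (fun w => chromatic_entropy (word_graph (fun i => Q (w i)))))).
  by apply: ler_mean => w; apply: le_word_entropy.
apply: (@chromatic_entropy_mixture _ (word_graph (fun _ : 'I_n => P)) _ _
  (fun w : {dffun forall i : 'I_n, A} => word_graph (fun i => Q (w i))) (fun _ => id)) => //.
move=> x; rewrite [LHS]mixture_prod; apply: eq_mean => w.
by rewrite dist_mapE -[LHS]mean_indicator.
Qed.

Lemma dist_inhabited (Y : finType) (L : dist R Y) : exists y : Y, true.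
Proof.
case: (pickP (@predT Y)) => [y _|Y0]; first by exists y.
by have := dist_sum1 L; rewrite big_pred0 // => /esym/eqP; rewrite oner_eq0.
Qed.

Lemma mean_prod_reindex (I J V : finType) (L : I -> dist R V) (s : J -> I)
    (f : {dffun forall j : J, V} -> R) : bijective s ->
  mean (dist_prod L) (fun x => f [ffun j => x (s j)])
    = mean (dist_prod (fun j => L (s j))) f.
Proof.
move=> [t st ts].
rewrite /mean (reindex (fun y : {dffun forall j : J, V} => [ffun i => y (t i)] : {dffun forall i : I, V})) /=; last first.
  by exists (fun x : {dffun forall i : I, V} => [ffun j => x (s j)]) => x _;
    apply/ffunP => i; rewrite !ffunE ?st ?ts.
apply: eq_bigr => y _; congr (_ * f _); last by apply/ffunP => j; rewrite !ffunE st.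
rewrite /dist_prod_pmf (reindex s) /=; last by exists t => ? _; [exact: st|exact: ts].
by apply: eq_bigr => j _; rewrite ffunE st.
Qed.

(** In the application [X] is the disjoint union and [label] is [tag]: edges stay inside a
    component, and [Q a] lives on component [a]. *)
Variable label : vertex X -> A.
Hypothesis label_edge : forall v w : vertex X, edge v w -> label v = label w.
Hypothesis label_supp : forall a v, label v != a -> Q a v = 0.

(** Permute the coordinates of a tuple until its labels spell a fixed word of the same type, and tag
    the result with that type. Adjacent tuples have equal labels, so this is a homomorphism to a
    disjoint union over types, which costs at most the logarithm of the number of types. *)
Lemma le_mean_counts_entropy n :
  chromatic_entropy (word_graph (fun _ : 'I_n => P))
    <= bits #|{ffun A -> 'I_n.+1}|%:R + mean (word_law n) (fun w => g (occ w)).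
Proof.
have [a0 _] := dist_inhabited PA.
pose W := {dffun forall i : 'I_n, A}; pose K := {ffun A -> 'I_n.+1}.
(* [N w] is the type of [w]; counts are at most [n], so [inord] loses nothing. *)
pose N (w : W) : K := [ffun a => inord (occ w a)].
have NE w w' : N w = N w' -> occ w =1 occ w'.
  move=> /ffunP h a; have := congr1 val (h a); rewrite !ffunE.
  by rewrite /= !inordK // ltnS; apply: leq_trans (max_card _) _; rewrite card_ord.
(* A chosen word of type [k]; the constant word is a default for vectors that are the type of no
   word. *)
pose r (k : K) : W := odflt [ffun=> a0] [pick w | N w == k].
have Nr w : N (r (N w)) = N w.
  by rewrite /r; case: pickP => [w' /eqP //|/(_ w)]; rewrite eqxx.
have /choice[s hs] (w : W) : exists s : 'I_n -> 'I_n,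
    bijective s /\ forall i, w (s i) = r (N w) i.
  have [a|s sI ws] := @fiberwise_injection 'I_n 'I_n A (r (N w)) w.
    by rewrite -[X in (X <= _)%N]/(occ _ a) (NE _ _ (Nr w)).
  by exists s; split=> //; apply: inj_card_bij.
pose Y k := word_graph (fun i => Q (r k i)).
pose L := dist_map N (word_law n).
pose lab (x : vertex (word_graph (fun _ : 'I_n => P))) : W := [ffun i => label (x i)].
pose h (x : vertex (word_graph (fun _ : 'I_n => P))) : vertex (disjoint_union L Y) :=
  Tagged (fun k => vertex (Y k)) ([ffun i => x (s (lab x) i)] : vertex (Y (N (lab x)))).
apply: le_trans (@chromatic_entropy_hom _ _ (disjoint_union L Y) h _ _) _.
- move=> x y /andP[nxy /forallP exy].
  have lxy : lab x = lab y.
    by apply/ffunP => i; rewrite !ffunE; have /orP[/eqP ->|/label_edge] := exy i.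
  rewrite /= /union_edge /= lxy eqxx /= /h.
  rewrite lxy tagged_asE; apply/andP; split.
    apply: contraNneq nxy => /ffunP exy'; apply/eqP/ffunP => i.
    have [[t st ts] _] := hs (lab y).
    by have := exy' (t i); rewrite !ffunE ts.
  by apply/forallP => i; rewrite !ffunE; exact: exy.
- move=> z; rewrite dist_mapE -[LHS]mean_indicator mean_mix mean_map mean_mixture_prod.
  apply: eq_mean => w.
  have [sw ws] := hs w.
  transitivity (mean (dist_prod (fun i => Q (w i))) (fun x =>
    (Tagged (fun k => vertex (Y k)) ([ffun i => x (s w i)] : vertex (Y (N w))) == z)%:R)).
    rewrite [RHS](mean_prod_reindex _ (fun x => (Tagged (fun k => vertex (Y k)) (x : vertex (Y (N w))) == z)%:R) sw).
    apply: eq_mean_dist => x; apply: eq_bigr => i _ /=.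
    by rewrite ws.
  (* Under the laws along [w], tuples whose labels do not spell [w] have mass 0; on the others, [h]
     permutes by [s w]. *)
  apply: eq_bigr => x _.
  have [lw|nlw] := eqVneq (lab x) w; first by rewrite /h lw.
  suff -> : dist_prod (fun i => Q (w i)) x = 0 by rewrite !mul0r.
  have [i li] : exists i, label (x i) != w i.
    apply/existsP; apply: contraNT nlw => /existsPn hi; apply/eqP/ffunP => i.
    by rewrite ffunE; have := hi i; rewrite negbK => /eqP.
  by rewrite /= /dist_prod_pmf (bigD1 i) //= label_supp // mul0r.
apply: le_trans (chromatic_entropy_union _ _) _.
apply: lerD; first exact: entropy_le_card.
rewrite mean_map; apply: ler_mean => w; apply: word_entropy_le => a.
by rewrite (NE _ _ (Nr w)).
Qed.

End Letters.

(** * Linear growth rates up to sublinear errors *)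

Section Asymptotics.
Variable R : realType.
Implicit Types (f a : nat -> R) (h c : R).

(* One-sided [o(n)]: [f] may tend to -oo. *)
Definition sublinear f :=
  forall e, 0 < e -> exists K, forall n, f n <= e * n%:R + K.

Lemma le_sublinear f f' : (forall n, f n <= f' n) -> sublinear f' -> sublinear f.
Proof.
by move=> ff' sf e /sf[K fK]; exists K => n; exact: le_trans (ff' n) (fK n).
Qed.

Lemma sublinear_cst c : sublinear (fun=> c).
Proof. by move=> e e0; exists c => n; rewrite lerDr mulr_ge0 // ltW. Qed.

Lemma sublinearD f f' :
  sublinear f -> sublinear f' -> sublinear (fun n => f n + f' n).
Proof.
move=> sf sf' e e0; have e2 : 0 < e / 2 by lra.
have [K fK] := sf _ e2; have [K' fK'] := sf' _ e2.
by exists (K + K') => n; have := fK n; have := fK' n; lra.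
Qed.

Lemma sublinearZ c (f : nat -> R) :
  0 <= c -> sublinear f -> sublinear (fun n => c * f n).
Proof.
move=> c0 sf e e0; have c1 : 0 < c + 1 by lra.
have [|K fK] := sf (e / (c + 1)); first by rewrite divr_gt0.
exists (c * K) => n; apply: le_trans (ler_wpM2l c0 (fK n)) _.
rewrite mulrDr lerD2r mulrA ler_wpM2r // mulrCA ler_piMr ?(ltW e0) //.
by rewrite ler_pdivrMr // mul1r; lra.
Qed.

Lemma sublinear_sum (I : finType) (f : I -> nat -> R) :
  (forall i, sublinear (f i)) -> sublinear (fun n => \sum_i f i n).
Proof.
move=> sf; suff : forall s : seq I, sublinear (fun n => \sum_(i <- s) f i n) by apply.
elim=> [|i s IH].
  by apply: le_sublinear (sublinear_cst 0) => n; rewrite big_nil.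
by apply: le_sublinear (sublinearD (sf i) IH) => n; rewrite big_cons.
Qed.

Lemma sublinear_mul f (q : nat) :
  sublinear f -> sublinear (fun n => f (q * n)%N).
Proof.
move=> sf e e0; have e1 : 0 < e / q.+1%:R by rewrite divr_gt0.
have [K fK] := sf _ e1; exists K => n.
apply: le_trans (fK _) _; rewrite lerD2r natrM mulrA ler_wpM2r //.
rewrite mulrAC ler_pdivrMr // ler_wpM2l ?ler_nat //; exact: ltW.
Qed.

(** Each inequality between growth rates is derived from this: the gap times [n] is bounded by a
    sublinear sequence. *)
Lemma sublinear_linear c : sublinear (fun n => c * n%:R) -> c <= 0.
Proof.
move=> sc; apply/ler_addgt0Pr => e e0; rewrite add0r leNgt; apply/negP => ce.
have [K cK] := sc _ e0.
have d0 : 0 < c - e by lra.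
have := archi_boundP (normr_ge0 (K / (c - e))).
set n := Num.bound _ => /(le_lt_trans (ler_norm _)).
by rewrite ltr_pdivrMr // => hK; have := cK n; lra.
Qed.

(** The affine bound on [f] is uniform over [w] because [X n w] is at most [n]. *)
Lemma sublinear_mean (S : nat -> finType) (L : forall n, dist R (S n))
    (X : forall n, S n -> nat) f :
  (forall n w, (X n w <= n)%N) -> sublinear f ->
  sublinear (fun n => mean (L n) (fun w => f (X n w))).
Proof.
move=> Xn sf e e0; have [K fK] := sf _ e0; exists K => n.
rewrite -[leRHS](mean_cst (L n)); apply: ler_mean => w.
apply: le_trans (fK _) _; rewrite lerD2r ler_wpM2l ?ler_nat //; exact: ltW.
Qed.

Lemma sublinear_bits (k : nat) :
  sublinear (fun n => bits ((n.+1 ^ k)%:R)).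
Proof.
suff s1 : sublinear (fun n => bits n.+1%:R).
  elim: k => [|k IH].
    by apply: le_sublinear (sublinear_cst 0) => n; rewrite expn0 /bits ln1 mul0r.
  apply: le_sublinear (sublinearD s1 IH) => n.
  by rewrite expnS natrM bitsM // posrE ltr0n // expn_gt0.
(* The tangent bound at [d * n.+1] gives [ln n.+1 <= d * n.+1 - 1 - ln d]; dividing by [ln 2] yields
   slope [e] and the constant below. *)
move=> e e0; pose d := e * ln 2; have d0 : 0 < d by rewrite mulr_gt0 // ln2_gt0.
exists ((d - ln d) / ln 2) => n.
rewrite /bits ler_pdivrMr ?ln2_gt0 // mulrDl divfK ?gt_eqF ?ln2_gt0 //.
have := @ln_leB1 R (d * n.+1%:R); rewrite mulr_gt0 // => /(_ isT).
rewrite lnM ?posrE // => hd.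
have -> : e * n%:R * ln 2 = d * n.+1%:R - d by rewrite /d -natr1; ring.
lra.
Qed.

(** The lower bound has no error term, as is the case for subadditive sequences, whose rate is the
    infimum of [a n / n]. *)
Definition rate a h := (forall n, h * n%:R <= a n) /\ sublinear (fun n => a n - h * n%:R).

(** Fekete's lemma: divide [n] by a nearly optimal rank [m.+1] and apply subadditivity to quotient
    and remainder. *)
Lemma rate_exists a : (forall n, 0 <= a n) ->
  (forall m n, a (m + n)%N <= a m + a n) -> exists h, rate a h.
Proof.
move=> a0 aD.
pose S : set R := [set a n.+1 / n.+1%:R | n in setT]%classic.
have Slb : has_lbound S by exists 0 => _ [n _ <-]; rewrite divr_ge0.
have S0 : (S !=set0)%classic by exists (a 1%N / 1%:R), 0%N.
have hle n : inf S * n%:R <= a n.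
  case: n => [|n]; first by rewrite mulr0.
  by rewrite -ler_pdivlMr //; apply: ge_inf => //; exists n.
have h0 : 0 <= inf S by apply: lb_le_inf => // _ [n _ <-]; rewrite divr_ge0.
exists (inf S); split=> // e e0.
have [_ [m _ <-] hm] := inf_adherent e0 (conj S0 Slb).
(* This constant absorbs the remainder term, whatever the residue of [n]. *)
exists (\sum_(r < m.+1) a r) => n; rewrite lerBlDr.
have aM q r : a (q * m.+1 + r)%N <= q%:R * a m.+1 + a r.
  elim: q => [|q IH]; first by rewrite mul0n add0n mul0r add0r.
  rewrite mulSn -addnA; apply: le_trans (aD _ _) _; rewrite -natr1; lra.
rewrite {1}(divn_eq n m.+1); apply: le_trans (aM _ _) _.
set q := (n %/ m.+1)%N; set r := (n %% m.+1)%N.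
have rm : (r < m.+1)%N by rewrite ltn_mod.
have ar : a r <= \sum_(i < m.+1) a i.
  by rewrite (bigD1 (Ordinal rm)) //= lerDl sumr_ge0.
have am : a m.+1 <= (inf S + e) * m.+1%:R by rewrite -ler_pdivrMr // ltW.
have : q%:R * a m.+1 <= q%:R * ((inf S + e) * m.+1%:R) by rewrite ler_wpM2l.
have : (inf S + e) * (q * m.+1)%:R <= (inf S + e) * n%:R.
  by rewrite ler_wpM2l ?ler_nat ?leq_trunc_div //; lra.
rewrite natrM; lra.
Qed.

Lemma rate_ge0 (a : nat -> R) x : (forall n, 0 <= a n) -> rate a x -> 0 <= x.
Proof.
move=> a0 [_ sa]; rewrite -oppr_le0; apply: sublinear_linear.
by apply: le_sublinear sa => n; have := a0 n; lra.
Qed.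

Lemma rate_lim a h : rate a h -> limn (fun n => a n / n%:R) = h.
Proof.
move=> [ha sa]; apply/cvg_lim => //; apply/cvgrPdist_le => e e0.
have e2 : 0 < e / 2 by lra.
have [K aK] := sa _ e2.
near=> n.
have n0 : 0 < n%:R :> R by rewrite ltr0n; near: n; exists 1%N.
have nK : `|K| / (e / 2) <= n%:R by near: n; exact: nbhs_infty_ger.
rewrite distrC ger0_norm ?subr_ge0 ?ler_pdivlMr //.
rewrite lerBlDr ler_pdivrMr //.
have := aK n; have := ler_norm K; move: nK; rewrite ler_pdivrMr //; lra.
Unshelve. all: by end_near.
Qed.

End Asymptotics.

(** * Moments of letter counts in a random word *)

Section OccurrenceMoments.
Variables (R : realType) (A : finType) (PA : dist R A).

Lemma mean_coord n (f : A -> R) (i : 'I_n) :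
  mean (word_law PA n) (fun w => f (w i)) = mean PA f.
Proof.
pose F (k : 'I_n) v := if k == i then f v else 1.
transitivity (mean (word_law PA n) (fun w => \prod_k F k (w k))).
  apply: eq_mean => w; rewrite (bigD1 i) //= /F eqxx big1 ?mulr1 //.
  by move=> k /negbTE ->.
rewrite (mean_prod (fun=> PA) F) (bigD1 i) //= big1 => [|k /negbTE ki].
  by rewrite mulr1; apply: eq_mean => v; rewrite /F eqxx.
by rewrite -[RHS](mean_cst PA); apply: eq_mean => v; rewrite /F ki.
Qed.

Lemma mean_coord2 n (f : A -> R) (i j : 'I_n) : i != j ->
  mean (word_law PA n) (fun w => f (w i) * f (w j)) = mean PA f * mean PA f.
Proof.
move=> ij; have ji : j != i by rewrite eq_sym.
pose F (k : 'I_n) v := if (k == i) || (k == j) then f v else 1.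
transitivity (mean (word_law PA n) (fun w => \prod_k F k (w k))).
  apply: eq_mean => w; rewrite (bigD1 i) //= (bigD1 j) //= /F !eqxx orbT.
  rewrite big1 ?mulr1 // => k /andP[/negbTE -> /negbTE ->] //.
rewrite (mean_prod (fun=> PA) F) (bigD1 i) //= (bigD1 j) //= big1.
  by rewrite mulr1; congr (_ * _); apply: eq_mean => v; rewrite /F eqxx ?orbT.
move=> k /andP[/negbTE ki /negbTE kj].
by rewrite -[RHS](mean_cst PA); apply: eq_mean => v; rewrite /F ki kj.
Qed.

Lemma occE n (w : {dffun forall i : 'I_n, A}) a :
  (occ w a)%:R = \sum_i (w i == a)%:R :> R.
Proof.
by rewrite /occ -sum1_card natr_sum big_mkcond; apply: eq_bigr => i _; rewrite inE; case: eqP.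
Qed.

Lemma occ_leq n (w : {dffun forall i : 'I_n, A}) a : (occ w a <= n)%N.
Proof. by rewrite -[X in (_ <= X)%N]card_ord max_card. Qed.

Lemma mean_occ n a :
  mean (word_law PA n) (fun w => (occ w a)%:R) = PA a * n%:R.
Proof.
under eq_mean => w do rewrite occE.
rewrite mean_sum (eq_bigr (fun=> PA a)) => [|i _].
  by rewrite sumr_const card_ord mulr_natr.
by rewrite (mean_coord (fun b => (b == a)%:R)) mean_indicator.
Qed.

(** The deviation is a sum of independent centered indicators: cross terms vanish, and each of the
    [n] diagonal terms is at most 1. *)
Lemma mean_occ_sqr_dev n a :
  mean (word_law PA n) (fun w => ((occ w a)%:R - PA a * n%:R) ^+ 2) <= n%:R.
Proof.
pose f b : R := (b == a)%:R - PA a.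
have f0 : mean PA f = 0.
  by rewrite /f meanD mean_indicator mean_cst subrr.
have f1 b : f b * f b <= 1.
  have := dist_le1 PA a; have := dist_ge0 PA a.
  by rewrite /f; case: eqP => _ /=; nra.
have -> : mean (word_law PA n) (fun w => ((occ w a)%:R - PA a * n%:R) ^+ 2)
    = mean (word_law PA n) (fun w => \sum_i \sum_j f (w i) * f (w j)).
  apply: eq_mean => w.
  have -> : (occ w a)%:R - PA a * n%:R = \sum_i f (w i).
    by rewrite /f sumrB sumr_const card_ord occE mulr_natr.
  by rewrite expr2 mulr_suml; apply: eq_bigr => i _; rewrite mulr_sumr.
rewrite mean_sum.
apply: (@le_trans _ _ (\sum_(i < n) 1)); last by rewrite sumr_const card_ord.
apply: ler_sum => i _; rewrite mean_sum (bigD1 i) //= big1 => [|j ji].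
  rewrite addr0 -(mean_cst (word_law PA n) 1); apply: ler_mean => w; exact: f1.
by rewrite mean_coord2 1?eq_sym // f0 mulr0.
Qed.

(** For t > 0, |D| <= D^2 / t + t, and D^2 has mean at most n. Taking t = e n leaves e n + 1/e; rank
    0 is apart, since t would vanish. *)
Lemma sublinear_mean_occ_dev a :
  sublinear (fun n => mean (word_law PA n)
    (fun w => `|(occ w a)%:R - PA a * n%:R|)).
Proof.
move=> e e0; exists e^-1 => -[|n].
  rewrite [e * _]mulr0 add0r -[leRHS](mean_cst (word_law PA 0)).
  apply: ler_mean => w; have := occ_leq w a; rewrite leqn0 => /eqP ->.
  by rewrite mulr0 subr0 normr0 invr_ge0 ltW.
pose t : R := e * n.+1%:R; have t0 : 0 < t by rewrite mulr_gt0.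
pose D w : R := (occ (w : {dffun forall i : 'I_n.+1, A}) a)%:R - PA a * n.+1%:R.
have DP w : `|D w| <= t^-1 * D w ^+ 2 + t.
  rewrite -(ler_pM2l t0) mulrDr mulrA divff ?gt_eqF // mul1r.
  have := sqr_ge0 (`|D w| - t); rewrite -(real_normK (num_real (D w))).
  have : 0 <= `|D w| by []. nra.
apply: le_trans (ler_mean (word_law PA n.+1) DP) _.
rewrite meanD meanZ mean_cst addrC lerD2l.
have /(ler_wpM2l (ltW (_ : 0 < t^-1))) := mean_occ_sqr_dev n.+1 a.
rewrite invr_gt0 => /(_ t0) h; apply: le_trans h _.
by rewrite /t invfM -mulrA mulVf ?mulr1 // pnatr_eq0.
Qed.

End OccurrenceMoments.

(** * AND products as words over the disjoint union *)

Section Embeddings.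
Variable R : realType.

Lemma chromatic_entropy_eq (X Y : pgraph R) (f : vertex Y -> vertex X) :
  injective f -> (forall v w, edge (f v) (f w) = edge v w) ->
  law X =1 dist_map f (law Y) ->
  chromatic_entropy X = chromatic_entropy Y.
Proof.
move=> fI ef lf; apply/eqP; rewrite eq_le; apply/andP; split.
  by apply: (chromatic_entropy_embed fI) => // v w; rewrite ef.
by apply: (@chromatic_entropy_hom _ _ _ f) => // v w; rewrite ef.
Qed.

Lemma chromatic_entropy_and_and (I A : finType) (G : A -> pgraph R) :
  chromatic_entropy (and_product (fun _ : I => and_product G))
    = chromatic_entropy (and_product (fun p : I * A => G p.2)).
Proof.
pose f (x : vertex (and_product (fun _ : I => and_product G))) :
    vertex (and_product (fun p : I * A => G p.2)) :=
  [ffun p : I * A => (x p.1 : {dffun forall a, vertex (G a)}) p.2 : vertex (G p.2)].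
have fE x i a : f x (i, a) = (x i : {dffun forall a, vertex (G a)}) a.
  by rewrite ffunE.
have fI : injective f.
  by move=> x y /ffunP fxy; apply/ffunP => i; apply/ffunP => a; rewrite -!fE fxy.
apply/esym/(chromatic_entropy_eq fI) => [x y|z].
  rewrite /= /and_edge (inj_eq fI); congr (_ && _).
  (* A block is equal or adjacent exactly when all its coordinates are: the disequality in the inner
     [and_edge] is absorbed by the equal case. *)
  apply/forallP/forallP => [h i|h [i a]] /=.
    have [//|nxy /=] := eqVneq (x i) (y i); rewrite /and_edge nxy.
    by apply/forallP => a; have := h (i, a); rewrite !fE.
  rewrite !fE; have /orP[/eqP ->|/andP[_ /forallP]] := h i; last exact.
  by rewrite eqxx.
rewrite dist_mapE.
pose F (i : I) (v : vertex (and_product G)) : R :=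
  \prod_a ((v : {dffun forall a, vertex (G a)}) a == z (i, a))%:R.
have fzE x : (f x == z)%:R = \prod_i F i (x i).
  rewrite pair_big /= prodr_bool; congr (_%:R); congr nat_of_bool.
  apply/eqP/forallP => [<- [i a] /=|h]; first by rewrite fE.
  by apply/ffunP => -[i a]; rewrite fE; apply/eqP; exact: h (i, a).
under eq_mean => x do rewrite fzE.
rewrite (mean_prod (fun _ : I => law (and_product G)) F).
rewrite [LHS](eq_bigr (fun p => (law (G p.2)) (z (p.1, p.2)))) => [|[i a] _ //].
rewrite -(pair_big xpredT xpredT (fun i a => law (G a) (z (i, a)))) /=.
apply: eq_bigr => i _.
rewrite [RHS](mean_prod (fun a => law (G a)) (fun a v => (v == z (i, a))%:R)).
by apply: eq_bigr => a _; rewrite mean_indicator.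
Qed.

Variables (A : finType) (PA : dist R A) (G : A -> pgraph R).

Definition component_law a : dist R (vertex (disjoint_union PA G)) :=
  dist_map (@Tagged A a (fun a => vertex (G a))) (law (G a)).

(** Tagging every coordinate embeds the product as an induced subgraph carrying all the mass. *)
Lemma chromatic_entropy_and_word (I : finType) (w : I -> A) :
  chromatic_entropy (and_product (fun i => G (w i)))
    = chromatic_entropy (word_graph (fun i => component_law (w i))).
Proof.
pose f (x : vertex (and_product (fun i => G (w i)))) :
    vertex (word_graph (fun i => component_law (w i))) :=
  [ffun i => Tagged (fun a => vertex (G a)) (x i)].
have fI : injective f.
  move=> x y /ffunP fxy; apply/ffunP => i.
  by have := fxy i; rewrite !ffunE => /eqP; rewrite eq_Tagged => /eqP.
apply/esym/(chromatic_entropy_eq fI) => [x y|z].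
  rewrite /= /and_edge (inj_eq fI); congr (_ && _).
  apply: eq_forallb => i; rewrite !ffunE eq_Tagged /= /union_edge /= eqxx.
  by rewrite tagged_asE.
rewrite dist_mapE.
pose F i (v : vertex (G (w i))) : R := (Tagged (fun a => vertex (G a)) v == z i)%:R.
under eq_mean => x.
  have -> : (f x == z)%:R = \prod_i F i (x i).
    rewrite prodr_bool; congr (_%:R); congr nat_of_bool.
    apply/eqP/forallP => [<- i|h]; first by rewrite ffunE.
    by apply/ffunP => i; rewrite ffunE; apply/eqP; exact: h i.
  over.
rewrite (mean_prod (fun i => law (G (w i))) F).
by apply: eq_bigr => i _; rewrite [LHS]dist_mapE.
Qed.

Local Notation g := (counts_entropy component_law).

Lemma and_power_component n a :
  chromatic_entropy (and_power (G a) n) = g (single a n).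
Proof.
rewrite (chromatic_entropy_and_word (fun _ : 'I_n => a)).
have oE b : occ (fun _ : 'I_n => a) b = single a n b.
  rewrite /occ /single; case: eqVneq => _; last exact: eq_card0.
  by rewrite -[RHS]card_ord; exact: eq_card.
apply/eqP; rewrite eq_le; apply/andP; split.
  by apply: word_entropy_le => b; rewrite oE.
by apply: le_word_entropy => b; rewrite oE.
Qed.

Lemma and_power_and_product n :
  chromatic_entropy (and_power (and_product G) n) = g (fun=> n).
Proof.
rewrite /and_power chromatic_entropy_and_and.
rewrite (chromatic_entropy_and_word (fun p : 'I_n * A => p.2)).
have oE b : occ (fun p : 'I_n * A => p.2) b = n.
  have bI : injective (fun i : 'I_n => (i, b)) by move=> i j [].
  rewrite /occ -[RHS]card_ord -(card_codom bI); apply: eq_card => -[i a].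
  rewrite !inE; apply/eqP/codomP => [/= ->|[j [_ ->]] //]; by exists i.
apply/eqP; rewrite eq_le; apply/andP; split.
  by apply: word_entropy_le => b; rewrite oE.
by apply: le_word_entropy => b; rewrite oE.
Qed.

Lemma law_disjoint_union v :
  law (disjoint_union PA G) v = mean PA (fun a => component_law a v).
Proof.
rewrite -[LHS]mean_indicator [LHS]mean_mix; apply: eq_mean => a.
by rewrite dist_mapE.
Qed.

Lemma component_law_supp a v : tag v != a -> component_law a v = 0.
Proof.
move=> va; rewrite [LHS]dist_mapE /mean big1 // => x _.
case: eqP => [vx|_]; last by rewrite mulr0.
by rewrite -vx eqxx in va.
Qed.

Lemma chromatic_entropy_powerD (X : pgraph R) m n :
  chromatic_entropy (and_power X (m + n))
    <= chromatic_entropy (and_power X m) + chromatic_entropy (and_power X n).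
Proof.
have E k : chromatic_entropy (and_power X k)
    = chromatic_entropy (word_graph (fun _ : 'I_k => law X)).
  by rewrite /and_power; case: X.
rewrite !E.
apply: le_trans (chromatic_entropy_word_sum (fun _ : 'I_m + 'I_n => law X)).
exact: (chromatic_entropy_word_mono (fun _ => law X) (can_inj (@splitK m n))).
Qed.

(** Subadditivity of the powers makes the limit in [complementary_entropy] a genuine one. *)
Lemma complementary_entropy_rate (X : pgraph R) :
  rate (fun n => chromatic_entropy (and_power X n)) (complementary_entropy X).
Proof.
have [h hr] := rate_exists (fun n => chromatic_entropy_ge0 (and_power X n))
  (chromatic_entropy_powerD X).
by rewrite /complementary_entropy (rate_lim hr).
Qed.

Lemma mean_counts_entropy_le_power n :
  mean (word_law PA n) (fun w => g (occ w))
    <= chromatic_entropy (and_power (disjoint_union PA G) n).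
Proof. exact: (mean_counts_entropy_le law_disjoint_union). Qed.

(** The number of types is polynomial in [n], so the first term is sublinear. *)
Lemma power_le_mean_counts_entropy n :
  chromatic_entropy (and_power (disjoint_union PA G) n)
    <= bits (n.+1 ^ #|A|)%:R + mean (word_law PA n) (fun w => g (occ w)).
Proof.
have := @le_mean_counts_entropy _ _ _ _ _ _ law_disjoint_union tag _ component_law_supp n.
by rewrite card_ffun card_ord; apply => v w /andP[/eqP].
Qed.

End Embeddings.

(** * Comparison of U and S with the linear bound *)

Section Linearization.
Variables (R : realType) (A : finType) (G : A -> pgraph R) (PA : dist R A).

Local Notation g := (counts_entropy (component_law PA G)).
Local Notation h a := (complementary_entropy (G a)).
Local Notation U := (complementary_entropy (disjoint_union PA G)).
Local Notation S := (complementary_entropy (and_product G)).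
Local Notation L := (\sum_a PA a * h a).
(** The excess of g(n e_a) over its linear growth: nonnegative and sublinear. *)
Local Notation defect a n := (g (single a n) - h a * n%:R).

Lemma component_rate a : rate (fun n => g (single a n)) (h a).
Proof.
have -> : (fun n => g (single a n)) = fun n => chromatic_entropy (and_power (G a) n).
  by apply/funext => n; rewrite (and_power_component PA).
exact: complementary_entropy_rate.
Qed.

Lemma and_product_rate : rate (fun n => g (fun=> n)) S.
Proof.
have -> : (fun n => g (fun=> n)) =
    fun n => chromatic_entropy (and_power (and_product G) n).
  by apply/funext => n; rewrite (and_power_and_product PA).
exact: complementary_entropy_rate.
Qed.

Lemma sublinear_mean_defect a (X : forall n, {dffun forall i : 'I_n, A} -> nat) :
  (forall n w, (X n w <= n)%N) ->
  sublinear (fun n => mean (word_law PA n) (fun w => defect a (X n w))).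
Proof.
move=> Xn; have [_ sa] := component_rate a.
exact: (sublinear_mean (word_law PA) (f := fun n => defect a n) Xn sa).
Qed.

Lemma mean_single n a (X : {dffun forall i : 'I_n, A} -> nat) :
  mean (word_law PA n) (fun w => g (single a (X w)))
    = mean (word_law PA n) (fun w => defect a (X w))
      + h a * mean (word_law PA n) (fun w => (X w)%:R).
Proof. by rewrite -meanZ -meanD; apply: eq_mean => w; rewrite subrK. Qed.

(** Split g(N) letter by letter: the count of [a] has mean [PA a * n], and the mean defects are
    sublinear. *)
Lemma union_le_linear : U <= L.
Proof.
rewrite -subr_le0; apply: sublinear_linear.
have sd a := sublinear_mean_defect a (X := fun n w => occ w a)
  (fun n w => occ_leq w a).
apply: le_sublinear (sublinearD (@sublinear_bits R #|A|) (sublinear_sum sd)) => n.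
have [/(_ n) Un _] := complementary_entropy_rate (disjoint_union PA G).
have un := power_le_mean_counts_entropy PA G n.
have gn := ler_mean (word_law PA n)
  (fun w => counts_entropy_le_sum (component_law PA G) (occ w)).
have E : mean (word_law PA n) (fun w => \sum_a g (single a (occ w a)))
    = \sum_a mean (word_law PA n) (fun w => defect a (occ w a)) + L * n%:R.
  rewrite mean_sum mulr_suml -big_split; apply: eq_bigr => a _ /=.
  by rewrite mean_single mean_occ; ring.
rewrite E in gn; lra.
Qed.

Lemma and_product_le_sum : S <= \sum_a h a.
Proof.
rewrite -subr_le0; apply: sublinear_linear.
have sd : sublinear (fun n => \sum_a defect a n).
  by apply: sublinear_sum => a; have [] := component_rate a.
apply: le_sublinear sd => n.
have [/(_ n) Sn _] := and_product_rate.
have := counts_entropy_le_sum (component_law PA G) (fun=> n).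
by rewrite sumrB -mulr_suml; lra.
Qed.

(* Any word of length [n] uses each letter at most [n] times, so it can be
   completed into a word where every letter occurs exactly [n] times. *)
Lemma and_product_le_union : S <= U + (\sum_a h a - L).
Proof.
rewrite -subr_le0; apply: sublinear_linear.
have [_ su] := complementary_entropy_rate (disjoint_union PA G).
have sd a := sublinear_mean_defect a (X := fun n w => (n - occ w a)%N)
  (fun n w => leq_subr (occ w a) n).
apply: le_sublinear (sublinearD su (sublinear_sum sd)) => n /=.
have [/(_ n) Sn _] := and_product_rate.
have un := mean_counts_entropy_le_power PA G n.
have gn (w : {dffun forall i : 'I_n, A}) :
    g (fun=> n) <= g (occ w) + \sum_a g (single a (n - occ w a)).
  apply: le_trans (lerD (lexx _) (counts_entropy_le_sum _ _)).
  apply: le_trans (counts_entropyD _ _ _).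
  by apply: counts_entropy_mono => a; rewrite subnKC // occ_leq.
have := ler_mean (word_law PA n) gn; rewrite mean_cst meanD mean_sum.
have -> : \sum_a mean (word_law PA n) (fun w => g (single a (n - occ w a)))
   = \sum_a mean (word_law PA n) (fun w => defect a (n - occ w a)%N)
     + (\sum_a h a - L) * n%:R.
  rewrite -sumrB mulr_suml -big_split; apply: eq_bigr => a _ /=.
  rewrite mean_single; congr (_ + _).
  (* Counts never exceed [n], so the truncated subtraction is exact and has mean
     [(1 - PA a) * n]. *)
  have -> : mean (word_law PA n) (fun w => (n - occ w a)%:R)
      = mean (word_law PA n) (fun w => n%:R + (-1) * (occ w a)%:R).
    by apply: eq_mean => w; rewrite natrB ?occ_leq // mulN1r.
  by rewrite meanD mean_cst meanZ mean_occ; ring.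
lra.
Qed.

(* Up to [o(m)], a random word of length [q * m] contains every letter [m]
   times, since [q * PA a >= 1]. *)
Lemma union_le_and_product (q : nat) : (forall a, 1 <= q%:R * PA a) ->
  q%:R * U <= S + (q%:R * L - \sum_a h a).
Proof.
move=> hq; rewrite -subr_le0; apply: sublinear_linear.
have q0 : (0 < q)%N.
  have [a _] := dist_inhabited PA; have := hq a.
  by case: q {hq} => // ; rewrite mul0r ler10.
have [_ sS] := and_product_rate.
have h0 a : 0 <= h a.
  exact: rate_ge0 (fun n => counts_entropy_ge0 _ _) (component_rate a).
have Xn a n (w : {dffun forall i : 'I_n, A}) : (occ w a - n %/ q <= n)%N.
  exact: leq_trans (leq_subr _ _) (occ_leq w a).
have sd a := sublinearD (sublinear_mean_defect a
  (X := fun n w => (occ w a - n %/ q)%N) (Xn a))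
  (sublinearZ (h0 a) (sublinear_mean_occ_dev PA a)).
(* Only lengths [q * m] are considered; there the threshold [n %/ q] is [m]. *)
have su := sublinear_mul q (sublinearD (@sublinear_bits R #|A|) (sublinear_sum sd)).
apply: le_sublinear (sublinearD sS su) => m /=; rewrite mulKn //.
set n := (q * m)%N.
have [/(_ n) Un _] := complementary_entropy_rate (disjoint_union PA G).
have un := power_le_mean_counts_entropy PA G n.
have gn (w : {dffun forall i : 'I_n, A}) :
    g (occ w) <= g (fun=> m) + \sum_a g (single a (occ w a - m)).
  apply: le_trans (lerD (lexx _) (counts_entropy_le_sum _ _)).
  apply: le_trans (counts_entropyD _ _ _).
  by apply: counts_entropy_mono => a; rewrite -leq_subLR.
have := ler_mean (word_law PA n) gn; rewrite meanD mean_cst mean_sum.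
have : \sum_a mean (word_law PA n) (fun w => g (single a (occ w a - m)))
   <= \sum_a (mean (word_law PA n) (fun w => defect a (occ w a - m)%N)
       + h a * mean (word_law PA n) (fun w => `|(occ w a)%:R - PA a * n%:R|))
     + (q%:R * L - \sum_a h a) * m%:R.
  have -> : (q%:R * L - \sum_a h a) * m%:R = \sum_a h a * (PA a * n%:R - m%:R).
    rewrite mulr_sumr -sumrB mulr_suml; apply: eq_bigr => a _.
    by rewrite /n natrM; ring.
  rewrite -big_split; apply: ler_sum => a _ /=.
  rewrite mean_single -addrA lerD2l -mulrDr; apply: ler_wpM2l => //.
  rewrite -[X in _ <= _ + X](mean_cst (word_law PA n)) -meanD; apply: ler_mean => w.
  (* This uses [1 <= q * PA a]. Since [PA a * n - m] is nonnegative, adding the absolute deviation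
     of the count bounds [occ w a - m] even where it truncates to 0. *)
  have mn : m%:R <= PA a * n%:R.
    have := ler_wpM2r (ler0n R m) (hq a); rewrite /n natrM; lra.
  have [ow|ow] := leqP m (occ w a).
    by rewrite natrB //; have := ler_norm ((occ w a)%:R - PA a * n%:R); lra.
  rewrite (eqP (ltnW ow)); have := normr_ge0 ((occ w a)%:R - PA a * n%:R); lra.
rewrite {1}/n natrM in Un; lra.
Qed.

End Linearization.

Theorem mainTheorem5 (R : realType) (A : finType) (G : A -> pgraph R)
    (PA : dist R A) (PA_full : forall a : A, 0 < PA a) :
  complementary_entropy (disjoint_union PA G)
    = \sum_(a : A) PA a * complementary_entropy (G a)
  <->
  complementary_entropy (and_product G)
    = \sum_(a : A) complementary_entropy (G a).
Proof.
split=> E.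
  (* By full support all inverses are positive, so [q] exceeds each of them. *)
  pose q := Num.bound (\sum_a (PA a)^-1).
  have hq a : 1 <= q%:R * PA a.
    rewrite -ler_pdivrMr // div1r; apply: ltW.
    apply: le_lt_trans (archi_boundP (sumr_ge0 _ _)) => [|b _]; last first.
      by rewrite invr_ge0 ltW.
    by rewrite (bigD1 a) //= lerDl sumr_ge0 // => b _; rewrite invr_ge0 ltW.
  (* When U = L, the terms q U and q L cancel, and the sum of the component entropies is at most
     S. *)
  have := union_le_and_product G hq; have := and_product_le_sum G PA.
  by rewrite E; lra.
(* When S is the sum of the component entropies, this bound reduces to L <= U. *)
have := and_product_le_union G PA; have := union_le_linear G PA.
by rewrite E; lra.
Qed.
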